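(* Consider the identity-investment model of the context. Let $D>0$ be the inherited platform distance, with $c\ne B_0(D)$ and $c\neq B_1(D)$, and suppose the wide-support condition holds for the three continuation electorates ($n=0,1,2$). If $c<B_0(D)$, investing is strictly dominant and both parties invest in the unique investment equilibrium. If $B_0(D)<c<B_1(D)$, mutual investment and mutual noninvestment are both pure-strategy investment equilibria. If $c>B_1(D)$, not investing is strictly dominant and neither party invests in the unique investment equilibrium. Moreover, suppose $$c<B_0(D_0),\qquad 4\gamma\eta<1,\qquad \phi>\Big(\frac{d}{1-4\gamma\eta}\Big)^2,$$ and take as the common feasible policy interval $\mathcal X=[\mu-\bar d/2,\ \mu+\bar d/2]$ with $\mu=(x_L+x_R)/2$ and $\bar d=d/(1-4\gamma\eta)$. Then at every state (inherited distance) generated from $D_0=\gamma d$ by investment choices followed by equilibrium platform play, investing is strictly dominant. Along the unique investment path, both parties invest in every election and the equilibrium platform distance satisfies $$D_t=D_0\sum_{s=0}^t(4\gamma\eta)^s\longrightarrow\frac{\gamma d}{1-4\gamma\eta},$$ and the identity-adjusted distance between the two voter groups increases from $d$ toward $\bar d$.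
   Context: There are two voter groups of mass $\frac12$ each with baseline ideal points $x_L<x_R$ in $\mathbb R$; $d=x_R-x_L$. Electoral game with group ideals $\tilde x_L<\tilde x_R$: parties $A,B$ choose platforms in a feasible interval containing $[\tilde x_L,\tilde x_R]$; group $i$ supports $A$ iff $\Delta_i=(x_B-\tilde x_i)^2-(x_A-\tilde x_i)^2\ge\epsilon$, with $\epsilon$ uniform on $[-\phi,\phi]$; party $p$'s gross payoff is $\mathbb E[\nu(S_p)]$, $S_p$ its vote share. Wide support: $\phi>(\tilde x_R-\tilde x_L)^2$, so that $|\Delta_i|<\phi$ for all platforms in $[\tilde x_L,\tilde x_R]$. Here $\nu=U\circ\rho$, $\nu(1)-\nu(0)=1$, with $\rho:[0,1]\to\mathbb R$ strictly increasing and $\rho(s)+\rho(1-s)$ constant, and $U$ continuous, strictly increasing, strictly concave. Put $\gamma=2\nu(\frac12)-\nu(1)-\nu(0)>0$. In the (essentially unique, up to party labels) pure-strategy equilibrium of this game the platform distance is $\gamma(\tilde x_R-\tilde x_L)$ and each party's gross payoff is $\frac{\nu(1)+\nu(0)}2+\frac{\gamma^2(\tilde x_R-\tilde x_L)^2}{2\phi}$. Dynamics: with no identity effect the initial platform distance is $D_0=\gamma d$. At each election $t\ge1$, given the inherited platform distance $D_{t-1}$, each party simultaneously chooses $a_p^t\in\{0,1\}$, paying $c>0$ if $a_p^t=1$. With $\theta_t=\eta(a_A^t+a_B^t)$, $\eta>0$, the identity-adjusted ideals are $\tilde x_L^t=x_L-\theta_tD_{t-1}$, $\tilde x_R^t=x_R+\theta_tD_{t-1}$.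 Parties then play the electoral game with these ideals; $D_t$ is the resulting equilibrium platform distance. Parties maximize the current equilibrium electoral payoff net of the current cost. Hence, if the inherited distance is $D$ and $n=a_A+a_B$ parties invest, the new platform distance is $D_n'(D)=\gamma(d+2n\eta D)$ and each party's gross payoff is $\Pi_n(D)=\frac{\nu(1)+\nu(0)}2+\frac{\gamma^2(d+2n\eta D)^2}{2\phi}$; the investment game at $D$ is the $2\times2$ game with payoffs $\Pi_{a_A+a_B}(D)-c\,a_p$. For $m\in\{0,1\}$, $$B_m(D)=\Pi_{m+1}(D)-\Pi_m(D)=\frac{2\gamma^2\eta D}{\phi}\big[d+(2m+1)\eta D\big].$$ *)

(* Defs.v *)
From HB Require Import structures.
From mathcomp Require Import all_boot all_order all_algebra.
From mathcomp Require Import all_classical all_reals all_analysis.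

Set Implicit Arguments.
Unset Strict Implicit.
Unset Printing Implicit Defensive.

Import Order.TTheory GRing.Theory Num.Theory.
Import numFieldNormedType.Exports.

Local Open Scope classical_set_scope.
Local Open Scope ring_scope.

Inductive party := PartyA | PartyB.

(* A strategy profile is a pair: party A's strategy, then party B's. *)
Definition own (S : Type) (p : party) (s : S * S) : S :=
  if p is PartyA then s.1 else s.2.

Definition deviate (S : Type) (p : party) (s : S * S) (x : S) : S * S :=
  if p is PartyA then (x, s.2) else (s.1, x).

Definition nash (R : realType) (S : Type) (feasible : set S)
    (u : party -> S * S -> R) (s : S * S) : Prop :=
  forall p, feasible (own p s) /\
    forall x, feasible x -> u p (deviate p s x) <= u p s.

Definition strictly_dominant (R : realType) (S : Type)
    (u : party -> S * S -> R) (k : S) : Prop :=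
  forall p s x, x <> k -> u p (deviate p s x) < u p (deviate p s k).

Definition strictly_concave_on (R : realType) (I : set R) (f : R -> R) : Prop :=
  forall x y t : R, I x -> I y -> x != y -> 0 < t < 1 ->
    t * f x + (1 - t) * f y < f (t * x + (1 - t) * y).

(* [utility], [cost] and [identity_rate] are the model's U, c and eta. [rho] and
   [utility] are total functions, constrained only on [0, 1] and on the interval
   spanned by the values of [rho] there. *)
Record identity_model (R : realType) := IdentityModel {
  xL : R;
  xR : R;
  phi : R;
  rho : R -> R;
  utility : R -> R;
  cost : R;
  identity_rate : R;
  xL_lt_xR : xL < xR;
  phi_gt0 : 0 < phi;
  rho_increasing : {in `[0, 1] &, {homo rho : s t / s < t}};
  rho_symmetric : exists k, forall s, 0 <= s <= 1 -> rho s + rho (1 - s) = k;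
  utility_continuous : {within `[rho 0, rho 1], continuous utility};
  utility_increasing : {in `[rho 0, rho 1] &, {homo utility : x y / x < y}};
  utility_concave : strictly_concave_on `[rho 0, rho 1] utility;
  nu_normalized : utility (rho 1) - utility (rho 0) = 1;
  cost_gt0 : 0 < cost;
  identity_rate_gt0 : 0 < identity_rate }.

Definition baseline_gap (R : realType) (m : identity_model R) : R := xR m - xL m.

Definition nu (R : realType) (m : identity_model R) (s : R) : R :=
  utility m (rho m s).

Definition gamma (R : realType) (m : identity_model R) : R :=
  2 * nu m 2^-1 - nu m 1 - nu m 0.

(* Electoral game; a platform profile is [x = (x_A, x_B)]. *)

Definition Delta (R : realType) (ideal : R) (x : R * R) : R :=
  (x.2 - ideal) ^+ 2 - (x.1 - ideal) ^+ 2.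

Definition vote_share (R : realType) (l r : R) (x : R * R) (p : party) (e : R)
    : R :=
  let sA := 2^-1 * ((e <= Delta l x)%R)%:R + 2^-1 * ((e <= Delta r x)%R)%:R in
  if p is PartyA then sA else 1 - sA.

(* [gtrN (phi_gt0 m)] is the proof of [- phi < phi] that [uniform_prob]
   requires. *)
Definition gross_payoff (R : realType) (m : identity_model R) (l r : R)
    (p : party) (x : R * R) : R :=
  fine ('E_(uniform_prob (gtrN (phi_gt0 m)))
         [fun e => nu m (vote_share l r x p e)])%E.

Definition electoral_equilibrium (R : realType) (m : identity_model R)
    (X : interval R) (l r : R) (x : R * R) : Prop :=
  nash [set` X] (gross_payoff m l r) x.

Definition wide_support (R : realType) (m : identity_model R) (l r : R) : Prop :=
  (r - l) ^+ 2 < phi m.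

(* Identity-adjusted ideals when the inherited platform distance is [D] and [n]
   parties invest. *)

Definition idealL (R : realType) (m : identity_model R) (D : R) (n : nat) : R :=
  xL m - identity_rate m * n%:R * D.

Definition idealR (R : realType) (m : identity_model R) (D : R) (n : nat) : R :=
  xR m + identity_rate m * n%:R * D.

(* Investment game; an investment profile is [a = (a_A, a_B)]. *)

Definition investors (a : bool * bool) : nat := (a.1 + a.2)%N.

(* Equilibrium platform play after each of the four investment profiles. The
   electoral equilibrium is unique only up to party labels, so it is a selection
   and not a function of the state. *)
Definition continuation (R : realType) (m : identity_model R) (X : interval R)
    (D : R) (sigma : bool * bool -> R * R) : Prop :=
  forall a, electoral_equilibrium m X
    (idealL m D (investors a)) (idealR m D (investors a)) (sigma a).

Definition net_payoff (R : realType) (m : identity_model R) (D : R)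
    (sigma : bool * bool -> R * R) (p : party) (a : bool * bool) : R :=
  gross_payoff m (idealL m D (investors a)) (idealR m D (investors a)) p (sigma a)
  - cost m * (own p a)%:R.

Definition pure_equilibrium (R : realType) (u : party -> bool * bool -> R)
    (a : bool * bool) : Prop := nash setT u a.

(* [q = (q_A, q_B)] are the probabilities of playing [true]. *)
Definition mixed_payoff (R : realType) (u : party -> bool * bool -> R)
    (p : party) (q : R * R) : R :=
  \sum_(a : bool * bool)
    (if a.1 then q.1 else 1 - q.1) * (if a.2 then q.2 else 1 - q.2) * u p a.

Definition mixed_equilibrium (R : realType) (u : party -> bool * bool -> R)
    (q : R * R) : Prop := nash `[0, 1] (mixed_payoff u) q.

(* Uniqueness among pure and among mixed strategies. *)
Definition unique_equilibrium (R : realType) (u : party -> bool * bool -> R)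
    (a : bool * bool) : Prop :=
  (forall a', pure_equilibrium u a' <-> a' = a) /\
  (forall q : R * R, mixed_equilibrium u q <-> q = (a.1%:R, a.2%:R)).

(* Pi_n: closed form of a party's gross equilibrium payoff when [n] parties
   invest. *)
Definition eq_payoff (R : realType) (m : identity_model R) (n : nat) (D : R)
    : R :=
  (nu m 1 + nu m 0) / 2
  + gamma m ^+ 2 * (baseline_gap m + 2 * n%:R * identity_rate m * D) ^+ 2
    / (2 * phi m).

(* B_k *)
Definition benefit (R : realType) (m : identity_model R) (k : nat) (D : R) : R :=
  eq_payoff m k.+1 D - eq_payoff m k D.

Definition initial_distance (R : realType) (m : identity_model R) : R :=
  gamma m * baseline_gap m.

Inductive reachable (R : realType) (m : identity_model R) (X : interval R)
    : R -> Prop :=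
| reachable0 : reachable m X (initial_distance m)
| reachableS (D : R) (a : bool * bool) (x : R * R) :
    reachable m X D ->
    electoral_equilibrium m X
      (idealL m D (investors a)) (idealR m D (investors a)) x ->
    reachable m X `|x.1 - x.2|.

(* [a t] and [sigma t] describe election [t.+1], played at inherited distance
   [D t]. *)
Record investment_path (R : realType) (m : identity_model R) (X : interval R)
    (D : nat -> R) (a : nat -> bool * bool)
    (sigma : nat -> bool * bool -> R * R) : Prop := InvestmentPath {
  path_init : D 0%N = initial_distance m;
  path_continuation : forall t, continuation m X (D t) (sigma t);
  path_equilibrium : forall t,
    pure_equilibrium (net_payoff m (D t) (sigma t)) (a t);
  path_step : forall t,
    D t.+1 = `|(sigma t (a t)).1 - (sigma t (a t)).2| }.

(* Distance between the groups' ideals at election [t]; index 0 is the baseline,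
   with no identity effect. *)
Definition identity_gap (R : realType) (m : identity_model R)
    (D : nat -> R) (a : nat -> bool * bool) (t : nat) : R :=
  if t is u.+1
  then idealR m (D u) (investors (a u)) - idealL m (D u) (investors (a u))
  else baseline_gap m.

Definition dbar (R : realType) (m : identity_model R) : R :=
  baseline_gap m / (1 - 4 * gamma m * identity_rate m).

Definition feasible_policies (R : realType) (m : identity_model R) : interval R :=
  `[(xL m + xR m) / 2 - dbar m / 2, (xL m + xR m) / 2 + dbar m / 2].

(* Main.v *)
Require Import Defs.
From HB Require Import structures.
From mathcomp Require Import all_boot all_order all_algebra.
From mathcomp Require Import all_classical all_reals all_analysis.
From mathcomp Require Import ring lra.

Set Implicit Arguments.
Unset Strict Implicit.
Unset Printing Implicit Defensive.

Import Order.TTheory GRing.Theory Num.Theory.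
Import numFieldNormedType.Exports.

Local Open Scope classical_set_scope.
Local Open Scope ring_scope.

(* Only the truncations of [Delta_L] and [Delta_R] to [- phi, phi] matter for
   payoffs. A party outside the span of the two ideals is never worse off at the
   nearer ideal, strictly better off unless it already wins for sure, and its
   opponent could then imitate it; so equilibria lie between the ideals, where
   nothing is truncated. There payoffs depend on -a^2 + k |a - b|, with [a] and
   [b] measured from the midpoint and k = gamma times the gap, and comparing with
   a = -k/2 and k/2 forces the platforms to be these two points. The investment
   game is thus a 2x2 game with payoffs Pi_n, and under mutual investment
   D_{t+1} = D_0 + (4 gamma eta) D_t. *)

(** * Uniform shocks and the gross payoffs in closed form *)

Definition truncate (R : realType) (b z : R) : R := Num.max (- b) (Num.min b z).

(** The distribution function of the uniform law on [[- b, b]]; the truncation makes the formula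
    valid for every [z]. *)
Definition win_prob (R : realType) (b z : R) : R := (b + truncate b z) / (2 * b).

Lemma uniform_prob_ray (R : realType) (b z : R) (ab : - b < b) :
  uniform_prob ab `]-oo, z] = (win_prob b z)%:E.
Proof.
have b0 : 0 < b by lra.
rewrite /uniform_prob integral_uniform_pdf.
rewrite (eq_integral (fun=> (b - - b)^-1%:E)); last first.
  by move=> x; rewrite inE => -[_] /=; rewrite in_itv/= /uniform_pdf => ->.
have -> : `]-oo, z] `&` `[- b, b] = [set` `[- b, Num.min b z]].
  apply/seteqP; split => x /=; rewrite !in_itv/= le_min.
    by case=> -> /andP[-> ->].
  by case/and3P=> -> -> ->.
rewrite integral_cst//= lebesgue_measure_itv/= lte_fin.
rewrite /win_prob /truncate; case: ifPn => [bz|].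
  rewrite (max_idPr (ltW bz)) -EFinB -EFinM opprK; congr EFin.
  by rewrite mulrC; congr (_ / _); ring.
by rewrite -leNgt => bz; rewrite mule0 (max_idPl bz) subrr mul0r.
Qed.

(** As a function of the shock, a payoff is a step function with jumps at the two [Delta]s, so
    linearity reduces its expectation to probabilities of rays. *)
Lemma expectation_two_steps (R : realType) (b : R) (ab : - b < b)
    (k0 k1 k2 z1 z2 : R) :
  fine ('E_(uniform_prob ab)
    [fun e : R => (k0 + k1 * (e <= z1)%R%:R + k2 * (e <= z2)%R%:R)%R])%E
  = k0 + k1 * win_prob b z1 + k2 * win_prob b z2.
Proof.
pose P : probability _ R := uniform_prob ab.
have PI (z : R) : P [set` `]-oo, z]] = (win_prob b z)%:E by exact: uniform_prob_ray.
have mI z : measurable (`]-oo, z] : set R) by exact: measurable_itv.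
have LI z : (\1_(`]-oo, z]) : R -> R) \in Lfun P 1.
  by apply/Lfun1_integrable; exact: integrable_indic.
have LZ k z : (k \o* (\1_(`]-oo, z]) : R -> R)) \in Lfun P 1.
  exact: Lfun_scale.
have L0 : (cst k0 : R -> R) \in Lfun P 1 by exact: Lfun_cst.
rewrite (_ : (fun e => _) = (cst k0 \+ (k1 \o* (\1_(`]-oo, z1])))) \+
    (k2 \o* (\1_(`]-oo, z2])))); last first.
  apply/funext => e /=; rewrite !indicE !mem_setE /= !in_itv/=.
  by rewrite ![_%:R * _]mulrC.
rewrite (_ : expectation _ _ = (k0%:E + k1%:E * (win_prob b z1)%:E
   + k2%:E * (win_prob b z2)%:E)%E) //.
rewrite (@expectationD _ _ _ P) ?rpredD//.
rewrite (@expectationD _ _ _ P)//.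
rewrite (@expectation_cst _ _ _ P) !(@expectationZl _ _ _ P)//.
by rewrite !(@expectation_indic _ _ _ P)// !PI.
Qed.

(* With probability [win_prob] of the larger [Delta] party A gets at least half
   the votes, and with that of the smaller one it gets all of them. *)
Lemma gross_payoffA (R : realType) (m : identity_model R) (l r : R) (x : R * R) :
  gross_payoff m l r PartyA x = nu m 0
   + (nu m 2^-1 - nu m 0) * win_prob (phi m) (Num.max (Delta l x) (Delta r x))
   + (nu m 1 - nu m 2^-1) * win_prob (phi m) (Num.min (Delta l x) (Delta r x)).
Proof.
rewrite /gross_payoff -(expectation_two_steps (gtrN (phi_gt0 m))).
congr (fine (expectation _ _)); apply/funext => e /=.
rewrite /vote_share le_max le_min.
case: (e <= Delta l x); case: (e <= Delta r x) => /=;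
  rewrite ?mulr1 ?mulr0 ?addr0 ?add0r //; last 1 first.
all: rewrite ?[_ + (_ - _)]addrC ?subrK//.
have -> : 2^-1 + 2^-1 = 1 :> R by lra.
by lra.
Qed.

Lemma gross_payoffB (R : realType) (m : identity_model R) (l r : R) (x : R * R) :
  gross_payoff m l r PartyB x = nu m 1
   - (nu m 1 - nu m 2^-1) * win_prob (phi m) (Num.max (Delta l x) (Delta r x))
   - (nu m 2^-1 - nu m 0) * win_prob (phi m) (Num.min (Delta l x) (Delta r x)).
Proof.
rewrite -!mulNr -(expectation_two_steps (gtrN (phi_gt0 m))).
congr (fine (expectation _ _)); apply/funext => e /=.
rewrite /vote_share le_max le_min.
have h1 : 2^-1 + 2^-1 = 1 :> R by lra.
have h2 : 1 - 2^-1 = 2^-1 :> R by lra.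
case: (e <= Delta l x); case: (e <= Delta r x) => /=;
  rewrite ?mulr1 ?mulr0 ?addr0 ?add0r ?h1 ?h2 ?subrr ?subr0 //; lra.
Qed.

(** Symmetry of the shock about zero; it brings B's payoff to the same form as A's. *)
Lemma win_probN (R : realType) (b z : R) : 0 < b ->
  win_prob b (- z) = 1 - win_prob b z.
Proof.
move=> b0; suff h : truncate b (- z) = - truncate b z.
  by rewrite /win_prob h; field; rewrite gt_eqF.
rewrite /truncate.
by case: (leP b z) => ?; case: (leP b (- z)) => ?;
  repeat (case: (leP (- b)) => ?); lra.
Qed.

Lemma win_prob_id (R : realType) (b z : R) : - b <= z <= b ->
  win_prob b z = (b + z) / (2 * b).
Proof.
by case/andP=> h1 h2; rewrite /win_prob /truncate (min_idPr h2) (max_idPr h1).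
Qed.

(** The distribution function is flat beyond [b] and below [- b]; the last two hypotheses keep [z]
    and [z'] from lying in the same flat part. *)
Lemma win_prob_lt (R : realType) (b z z' : R) : 0 < b -> z < z' ->
  z < b -> - b < z' -> win_prob b z < win_prob b z'.
Proof.
move=> b0 zz' zb bz'; rewrite /win_prob ltr_pM2r ?invr_gt0 ?mulr_gt0 ?ltrD2l//.
rewrite /truncate.
by case: (leP b z) => ?; case: (leP b z') => ?; repeat (case: (leP (- b)) => ?); lra.
Qed.

Lemma win_prob_le (R : realType) (b z z' : R) : 0 < b -> z <= z' ->
  win_prob b z <= win_prob b z'.
Proof.
move=> b0 zz'; rewrite /win_prob ler_pM2r ?invr_gt0 ?mulr_gt0 ?lerD2l//.
by rewrite /truncate ge_max !le_max lexx /= !le_min !ge_min lexx zz' !orbT.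
Qed.

(** * The platform contest between two reals *)

(* Gross payoff above [nu 0] of a party at [a] facing a party at [b], when
   [gamma = g] and [phi = f]. *)
Definition contest (R : realType) (g f l r a b : R) : R :=
  (1 + g) / 2 * win_prob f (Num.max (Delta l (a, b)) (Delta r (a, b)))
  + (1 - g) / 2 * win_prob f (Num.min (Delta l (a, b)) (Delta r (a, b))).

Lemma Delta_swap (R : realType) (i a b : R) : Delta i (b, a) = - Delta i (a, b).
Proof. by rewrite /Delta opprB. Qed.

Lemma contest_refl (R : realType) (g f l r a : R) : 0 < f ->
  contest g f l r a a = 2^-1.
Proof.
move=> f0; rewrite /contest /Delta !subrr maxxx minxx win_prob_id; last first.
  by rewrite oppr_le0 ltW.
by field; rewrite gt_eqF.
Qed.

(** Reflecting the line exchanges the two groups; claims about the left side follow from those about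
    the right. *)
Lemma contest_opp (R : realType) (g f l r a b : R) :
  contest g f (- r) (- l) (- a) (- b) = contest g f l r a b.
Proof.
have h i : Delta (- i) (- a, - b) = Delta i (a, b) by rewrite /Delta /=; ring.
by rewrite /contest !h maxC minC.
Qed.

(** Between the ideals no [Delta] is truncated, so the payoff is affine in the mean of the two
    [Delta]s plus [g] times half their gap. The mean is the difference of squared distances to the
    midpoint, and half the gap is [(r - l) * |a - b|]. *)
Lemma contest_inside (R : realType) (g f l r a b : R) : 0 <= g ->
  (r - l) ^+ 2 < f -> l <= a <= r -> l <= b <= r ->
  contest g f l r a b = 2^-1 + ((b - (l + r) / 2) ^+ 2 - (a - (l + r) / 2) ^+ 2
     + g * (r - l) * `|a - b|) / (2 * f).
Proof.
move=> g0 hf /andP[la ar] /andP[lb br].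
have f0 : 0 < f by apply: le_lt_trans hf; exact: sqr_ge0.
have D_ok i : i = l \/ i = r -> - f <= Delta i (a, b) <= f.
  by rewrite /Delta /= => -[->|->]; apply/andP; split; nra.
rewrite /contest.
have [ab|ba] := leP a b.
  have Dlr : Delta r (a, b) <= Delta l (a, b) by rewrite /Delta/=; nra.
  rewrite (max_idPl Dlr) (min_idPr Dlr) !win_prob_id ?D_ok; auto.
  rewrite ler0_norm ?subr_le0// /Delta /=; field; rewrite gt_eqF//.
have Dlr : Delta l (a, b) <= Delta r (a, b) by rewrite /Delta/=; nra.
rewrite (max_idPr Dlr) (min_idPl Dlr) !win_prob_id ?D_ok; auto.
by rewrite gtr0_norm ?subr_gt0// /Delta /=; field; rewrite gt_eqF.
Qed.

(** Returning to [r] brings the party closer to both groups, which raises both [Delta]s, hence their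
    maximum and minimum. *)
Lemma contest_le_right (R : realType) (g f l r a b : R) : -1 <= g <= 1 ->
  0 < f -> l <= r -> r <= a -> contest g f l r a b <= contest g f l r r b.
Proof.
move=> /andP[g0 g1] f0 lr ra.
have hl : Delta l (a, b) <= Delta l (r, b) by rewrite /Delta/=; nra.
have hr : Delta r (a, b) <= Delta r (r, b) by rewrite /Delta/=; nra.
apply: lerD; apply: ler_wpM2l; try lra; apply: win_prob_le => //.
  by rewrite ge_max !le_max hl hr orbT.
by rewrite le_min !ge_min hl hr orbT.
Qed.

Lemma contest_le_left (R : realType) (g f l r a b : R) : -1 <= g <= 1 ->
  0 < f -> l <= r -> a <= l -> contest g f l r a b <= contest g f l r l b.
Proof.
move=> g01 f0 lr al; rewrite -contest_opp -(contest_opp g f l r l b).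
by apply: contest_le_right => //; rewrite lerN2.
Qed.

(* Moving from [a > r] to [r] brings a party closer to both groups, which is
   useless only if it already wins for sure; then its opponent never does. *)
Lemma contest_right_sure_win (R : realType) (g f l r a b : R) : -1 <= g < 1 ->
  (r - l) ^+ 2 < f -> l <= r -> r < a ->
  contest g f l r r b <= contest g f l r a b -> contest g f l r b a = 0.
Proof.
move=> /andP[g0 g1] hf lr ra.
have f0 : 0 < f by apply: le_lt_trans hf; exact: sqr_ge0.
have hl : Delta l (a, b) < Delta l (r, b) by rewrite /Delta/=; nra.
have hr : Delta r (a, b) < Delta r (r, b) by rewrite /Delta/=; nra.
(* From [r], either ideal is at distance at most [r - l], so wide support keeps both [Delta]s out of
   the lower flat part. *)
have hl' : - f < Delta l (r, b).
  by rewrite /Delta/=; have := sqr_ge0 (b - l); lra.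
have hr' : - f < Delta r (r, b).
  by rewrite /Delta/=; have := sqr_ge0 (b - r); lra.
(* If the smaller [Delta] is below [f], moving to [r] strictly raises the term of positive weight
   [(1 - g) / 2], against the hypothesis. *)
have [small|large _] := ltP (Num.min (Delta l (a, b)) (Delta r (a, b))) f.
  rewrite leNgt => /negP[]; apply: ler_ltD.
    apply: ler_wpM2l; first lra.
    by apply: win_prob_le => //; rewrite ge_max !le_max (ltW hl) (ltW hr) orbT.
  rewrite ltr_pM2l; last lra.
  by apply: win_prob_lt => //; rewrite lt_min ?hl' ?hr'// !gt_min hl hr orbT.
(* Otherwise both [Delta]s are at least [f]; the rival's are their opposites, so it wins with
   probability zero. *)
move: large; rewrite le_min => /andP[fl fr].
have E z : z <= - f -> win_prob f z = 0.
  move=> zf; rewrite /win_prob /truncate (max_idPl _) ?subrr ?mul0r//.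
  by rewrite ge_min zf orbT.
rewrite /contest ![Delta _ (b, a)]Delta_swap !E ?mulr0 ?addr0//.
  by rewrite ge_min !lerN2 fl.
by rewrite ge_max !lerN2 fl fr.
Qed.

(** * Equilibria of the platform contest *)

Definition contest_eq (R : realType) (X : interval R) (g f l r a b : R) : Prop :=
  [/\ a \in X, b \in X,
    forall x, x \in X -> contest g f l r x b <= contest g f l r a b
  & forall x, x \in X -> contest g f l r x a <= contest g f l r b a].

Lemma contest_eq_sym (R : realType) (X : interval R) (g f l r a b : R) :
  contest_eq X g f l r a b -> contest_eq X g f l r b a.
Proof. by case. Qed.

Lemma contest_eq_inside (R : realType) (X : interval R) (g f l r a b : R) :
  -1 <= g < 1 -> (r - l) ^+ 2 < f -> l <= r -> l \in X -> r \in X ->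
  contest_eq X g f l r a b -> l <= a <= r.
Proof.
move=> g01 hf lr lX rX [aX _ ha hb].
have f0 : 0 < f by apply: le_lt_trans hf; exact: sqr_ge0.
(* Imitating the opponent yields one half, so nobody earns zero in equilibrium. *)
have nz : contest g f l r b a <> 0.
  by move=> h; have := hb a aX; rewrite h contest_refl// leNgt invr_gt0 ltr0n.
rewrite !leNgt -negb_or; apply/negP => /orP[al|ra]; apply: nz.
  rewrite -contest_opp; apply: contest_right_sure_win; rewrite ?lerN2 ?ltrN2//.
    by rewrite opprK addrC.
  by rewrite !contest_opp; exact: ha.
by apply: contest_right_sure_win => //; exact: ha.
Qed.

(** Measured from the midpoint, with [a <= b], the payoff at [a] is governed by [- a ^+ 2 - k * a],
    a downward parabola peaking at [- k / 2]. That this deviation does not pay forces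
    [(a + k / 2) ^+ 2 <= 0]; symmetrically for [b]. *)
Lemma contest_eq_ordered (R : realType) (X : interval R) (g f l r a b : R) :
  0 <= g < 1 -> (r - l) ^+ 2 < f -> l <= r ->
  `[l, r] `<=` [set` X] -> a <= b ->
  contest_eq X g f l r a b ->
  a = (l + r) / 2 - g * (r - l) / 2 /\ b = (l + r) / 2 + g * (r - l) / 2.
Proof.
move=> /andP[g0 g1] hf lr lrX ab e.
have f0 : 0 < f by apply: le_lt_trans hf; exact: sqr_ge0.
have g01 : -1 <= g < 1 by rewrite g1 andbT; lra.
have inX x : l <= x <= r -> x \in X by move=> h; apply: lrX; rewrite /= in_itv.
have lX : l \in X by apply: inX; rewrite lexx.
have rX : r \in X by apply: inX; rewrite lexx lr.
have ia := contest_eq_inside g01 hf lr lX rX e.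
have ib := contest_eq_inside g01 hf lr lX rX (contest_eq_sym e).
case: e => _ _ ha hb.
set k := g * (r - l); set mu := (l + r) / 2.
have k0 : 0 <= k by rewrite mulr_ge0 ?subr_ge0.
have k1 : k <= r - l by rewrite ler_piMl ?subr_ge0// ltW.
have il : l <= mu - k / 2 <= r by rewrite /mu; apply/andP; split; lra.
have ir : l <= mu + k / 2 <= r by rewrite /mu; apply/andP; split; lra.
have := ha _ (inX _ il); have := hb _ (inX _ ir).
rewrite !contest_inside// -/mu -/k !lerD2l !ler_pM2r ?invr_gt0 ?mulr_gt0//.
rewrite (distrC b a) [`|a - b|]ler0_norm ?subr_le0//.
(* At the deviations a lower bound on the distance to the rival suffices, so their order need not be
   known. *)
have := ler_wpM2l k0 (ler_norm (mu + k / 2 - a)).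
have := ler_wpM2l k0 (ler_norm (b - (mu - k / 2))); rewrite (distrC b).
move=> hu hv h1 h2.
split; apply/eqP; rewrite -subr_eq0 -sqrf_eq0 eq_le sqr_ge0 andbT; nra.
Qed.

(** Exchanging labels covers both orders. The platforms are symmetric about the midpoint, so in
    [contest_inside] the squares cancel and only the distance term remains. *)
Lemma contest_eq_distance (R : realType) (X : interval R) (g f l r a b : R) :
  0 <= g < 1 -> (r - l) ^+ 2 < f -> l <= r ->
  `[l, r] `<=` [set` X] -> contest_eq X g f l r a b ->
  `|a - b| = g * (r - l) /\
  contest g f l r a b = 2^-1 + (g * (r - l)) ^+ 2 / (2 * f).
Proof.
move=> g01 hf lr lrX e; have /andP[g0 g1] := g01.
have k0 : 0 <= g * (r - l) by rewrite mulr_ge0 ?subr_ge0.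
have k1 : g * (r - l) <= r - l by rewrite ler_piMl ?subr_ge0// ltW.
have inX x : l <= x <= r -> x \in X by move=> h; apply: lrX; rewrite /= in_itv.
have lX : l \in X by apply: inX; rewrite lexx.
have rX : r \in X by apply: inX; rewrite lexx lr.
have g01' : -1 <= g < 1 by rewrite g1 andbT; lra.
have ia := contest_eq_inside g01' hf lr lX rX e.
have ib := contest_eq_inside g01' hf lr lX rX (contest_eq_sym e).
suff [d s] : `|a - b| = g * (r - l) /\
    (b - (l + r) / 2) ^+ 2 = (a - (l + r) / 2) ^+ 2.
  by rewrite contest_inside// d s subrr add0r -expr2.
have [ab|/ltW ba] := leP a b.
  have [-> ->] := contest_eq_ordered g01 hf lr lrX ab e.
  by split; [rewrite ler0_norm; [field|lra] | ring].
have [-> ->] := contest_eq_ordered g01 hf lr lrX ba (contest_eq_sym e).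
by split; [rewrite ger0_norm; [field|lra] | ring].
Qed.

Lemma contest_eq_exists (R : realType) (X : interval R) (g f l r : R) :
  0 <= g <= 1 -> (r - l) ^+ 2 < f -> l <= r -> `[l, r] `<=` [set` X] ->
  contest_eq X g f l r
    ((l + r) / 2 - g * (r - l) / 2) ((l + r) / 2 + g * (r - l) / 2).
Proof.
move=> /andP[g0 g1] hf lr lrX.
have f0 : 0 < f by apply: le_lt_trans hf; exact: sqr_ge0.
have g01 : -1 <= g <= 1 by rewrite g1 andbT; lra.
have inX x : l <= x <= r -> x \in X by move=> h; apply: lrX; rewrite /= in_itv.
set k := g * (r - l); set mu := (l + r) / 2.
have k0 : 0 <= k by rewrite mulr_ge0 ?subr_ge0.
have k1 : k <= r - l by rewrite ler_piMl ?subr_ge0.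
have il : l <= mu - k / 2 <= r by rewrite /mu; apply/andP; split; lra.
have ir : l <= mu + k / 2 <= r by rewrite /mu; apply/andP; split; lra.
(* A deviation outside [[l, r]] is no better than the nearer endpoint, so only inner deviations are
   left to check. *)
have best b c : l <= b <= r -> l <= c <= r ->
    (forall x, l <= x <= r -> contest g f l r x b <= contest g f l r c b) ->
    forall x, x \in X -> contest g f l r x b <= contest g f l r c b.
  move=> ib ic h x _.
  have [xl|lx] := leP x l.
    by apply: le_trans (contest_le_left _ g01 f0 lr xl) (h _ _); rewrite lexx.
  have [rx|xr] := leP r x.
    by apply: le_trans (contest_le_right _ g01 f0 lr rx) (h _ _); rewrite lr lexx.
  by apply: h; rewrite !ltW.
split; [exact: inX|exact: inX| |]; apply: best => // x ix;
  rewrite !contest_inside// -/mu -/k !lerD2l ler_pM2r ?invr_gt0 ?mulr_gt0//.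
  (* With [y = x - mu], the claim is [(y + k / 2) ^+ 2 >= 0] left of the rival and
     [(y - k / 2) ^+ 2 + k ^+ 2 >= 0] right of it. *)
  rewrite [`|mu - _ - _|]ler0_norm; last lra.
  have := sqr_ge0 (x - mu + k / 2); have := sqr_ge0 (x - mu - k / 2).
  by have := sqr_ge0 k; case: (ger0P (x - (mu + k / 2))) => _; lra.
rewrite [`|mu + _ - _|]ger0_norm; last lra.
have := sqr_ge0 (x - mu + k / 2); have := sqr_ge0 (x - mu - k / 2).
by have := sqr_ge0 k; case: (ger0P (x - (mu - k / 2))) => _; lra.
Qed.

(** * Electoral equilibrium in the model *)

(** By symmetry [rho] sends one half to the midpoint of [rho 0] and [rho 1], where strict concavity
    of [utility] applies. *)
Lemma gamma_gt0 (R : realType) (m : identity_model R) : 0 < gamma m.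
Proof.
have [k rk] := rho_symmetric m.
have h01 : 0 <= (0 : R) <= 1 by rewrite lexx ler01.
have hh : 0 <= (2^-1 : R) <= 1 by lra.
have e0 := rk _ h01; have e1 := rk _ hh.
have h2 : 1 - 2^-1 = 2^-1 :> R by lra.
move: e0 e1; rewrite subr0 h2 => e0 e1.
have r01 : rho m 0 < rho m 1.
  by apply: rho_increasing; rewrite ?in_itv/= ?lexx ?ler01.
have := @utility_concave _ m (rho m 0) (rho m 1) 2^-1.
rewrite /= !in_itv/= !lexx (ltW r01) lt_eqF// h2 => /(_ isT isT isT).
rewrite (_ : 0 < 2^-1 < 1); last lra.
rewrite (_ : 2^-1 * rho m 0 + 2^-1 * rho m 1 = rho m 2^-1); last lra.
by move=> /(_ isT); rewrite /gamma /nu; lra.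
Qed.

(** By the normalization, [1 - gamma] is twice [nu 1 - nu 2^-1]. *)
Lemma gamma_lt1 (R : realType) (m : identity_model R) : gamma m < 1.
Proof.
have mono (s t : R) : 0 <= s -> s < t -> t <= 1 -> rho m s < rho m t.
  by move=> *; apply: rho_increasing => //; rewrite in_itv/=; lra.
have h0 : rho m 0 < rho m 2^-1 by apply: mono; lra.
have h1 : rho m 2^-1 < rho m 1 by apply: mono; lra.
have : utility m (rho m 2^-1) < utility m (rho m 1).
  by apply: utility_increasing => //; rewrite in_itv/=; lra.
by have := nu_normalized m; rewrite /gamma /nu; lra.
Qed.

Definition rival (p : party) : party := if p is PartyA then PartyB else PartyA.

(** The normalization turns the utility increments at one half into the weights [(1 + gamma) / 2]
    and [(1 - gamma) / 2]. Seen from B, the [Delta]s change sign and maximum and minimum trade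
    places, so one formula serves both parties. *)
Lemma gross_payoff_contest (R : realType) (m : identity_model R) (l r : R)
    (p : party) (x : R * R) :
  gross_payoff m l r p x =
    nu m 0 + contest (gamma m) (phi m) l r (own p x) (own (rival p) x).
Proof.
have n1 : nu m 1 - nu m 0 = 1 := nu_normalized m.
have hw : nu m 2^-1 - nu m 0 = (1 + gamma m) / 2 by rewrite /gamma; lra.
have hl : nu m 1 - nu m 2^-1 = (1 - gamma m) / 2 by rewrite /gamma; lra.
case: x p => a b [] /=; rewrite /contest.
  by rewrite gross_payoffA hw hl; lra.
rewrite gross_payoffB hw hl ![Delta _ (b, a)]Delta_swap -oppr_min -oppr_max.
by rewrite !win_probN ?phi_gt0//; lra.
Qed.

Lemma electoral_equilibriumE (R : realType) (m : identity_model R)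
    (X : interval R) (l r : R) (x : R * R) :
  electoral_equilibrium m X l r x <->
  contest_eq X (gamma m) (phi m) l r x.1 x.2.
Proof.
case: x => a b; split.
  move=> h; have [aX ha] := h PartyA; have [bX hb] := h PartyB.
  split=> // x xX.
    by have := ha x xX; rewrite !gross_payoff_contest lerD2l.
  by have := hb x xX; rewrite !gross_payoff_contest lerD2l.
case=> /= aX bX ha hb [] /=; split=> // x xX;
  by rewrite !gross_payoff_contest lerD2l /=; auto.
Qed.

Lemma electoral_equilibrium_exists (R : realType) (m : identity_model R)
    (X : interval R) (l r : R) :
  wide_support m l r -> l <= r -> `[l, r] `<=` [set` X] ->
  exists x, electoral_equilibrium m X l r x.
Proof.
move=> ws lr lrX.
exists ((l + r) / 2 - gamma m * (r - l) / 2, (l + r) / 2 + gamma m * (r - l) / 2).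
apply/electoral_equilibriumE/contest_eq_exists => //.
by rewrite !ltW ?gamma_gt0 ?gamma_lt1.
Qed.

(** Distance and payoffs do not depend on the labels, so any selection of equilibria gives the same
    investment game and the same next state. *)
Lemma electoral_equilibrium_outcome (R : realType) (m : identity_model R)
    (X : interval R) (l r : R) (x : R * R) :
  wide_support m l r -> l <= r -> `[l, r] `<=` [set` X] ->
  electoral_equilibrium m X l r x ->
  `|x.1 - x.2| = gamma m * (r - l) /\
  forall p, gross_payoff m l r p x =
    (nu m 1 + nu m 0) / 2 + gamma m ^+ 2 * (r - l) ^+ 2 / (2 * phi m).
Proof.
move=> ws lr lrX /electoral_equilibriumE e.
have g01 : 0 <= gamma m < 1 by rewrite ltW ?gamma_gt0 ?gamma_lt1.
have [d pA] := contest_eq_distance g01 ws lr lrX e.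
have [_ pB] := contest_eq_distance g01 ws lr lrX (contest_eq_sym e).
have n1 : nu m 1 - nu m 0 = 1 := nu_normalized m.
split=> // p; rewrite gross_payoff_contest -exprMn.
by case: p => /=; rewrite ?pA ?pB; lra.
Qed.

(** * Identity-adjusted electorates and the benefit of investing *)

Lemma ideal_gap (R : realType) (m : identity_model R) (D : R) (n : nat) :
  idealR m D n - idealL m D n = baseline_gap m + 2 * n%:R * identity_rate m * D.
Proof. by rewrite /idealR /idealL /baseline_gap; ring. Qed.

Lemma baseline_gap_gt0 (R : realType) (m : identity_model R) :
  0 < baseline_gap m.
Proof. by rewrite subr_gt0 xL_lt_xR. Qed.

Lemma ideal_le (R : realType) (m : identity_model R) (D : R) (n : nat) :
  0 <= D -> idealL m D n <= idealR m D n.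
Proof.
move=> D0; rewrite -subr_ge0 ideal_gap addr_ge0 ?(ltW (baseline_gap_gt0 m))//.
by rewrite !mulr_ge0 ?(ltW (identity_rate_gt0 m)).
Qed.

Lemma benefitE (R : realType) (m : identity_model R) (k : nat) (D : R) :
  benefit m k D = 2 * gamma m ^+ 2 * identity_rate m * D / phi m *
    (baseline_gap m + (2 * k%:R + 1) * identity_rate m * D).
Proof.
rewrite /benefit /eq_payoff -natr1; field.
by rewrite gt_eqF ?phi_gt0.
Qed.

(** At fixed [D] this is strategic complementarity, B_0 at most B_1; in the dynamics it carries
    [c < B_0(D_0)] to larger inherited distances. *)
Lemma benefit_le (R : realType) (m : identity_model R) (k k' : nat) (D D' : R) :
  (k <= k')%N -> 0 <= D <= D' -> benefit m k D <= benefit m k' D'.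
Proof.
move=> kk' /andP[D0 DD']; rewrite !benefitE.
have g0 := ltW (gamma_gt0 m); have e0 := ltW (identity_rate_gt0 m).
have d0 := baseline_gap_gt0 m; have f0 := phi_gt0 m.
have kR : 2 * k%:R + 1 <= 2 * k'%:R + 1 :> R by rewrite lerD2r ler_pM2l ?ler_nat.
have k0 : 0 <= 2 * k%:R + 1 :> R by rewrite addr_ge0// mulr_ge0.
have D'0 := le_trans D0 DD'.
apply: ler_pM.
- by rewrite divr_ge0 ?mulr_ge0 ?(ltW f0).
- by rewrite addr_ge0 ?(ltW d0) ?mulr_ge0.
- by rewrite ler_pM2r ?invr_gt0// ler_wpM2l// ?mulr_ge0.
- by rewrite lerD2l ler_pM ?mulr_ge0// ler_wpM2r.
Qed.

Lemma net_payoffE (R : realType) (m : identity_model R) (X : interval R) (D : R)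
    (sigma : bool * bool -> R * R) :
  0 <= D ->
  (forall n, (n <= 2)%N -> wide_support m (idealL m D n) (idealR m D n)) ->
  (forall n, (n <= 2)%N -> `[idealL m D n, idealR m D n] `<=` [set` X]) ->
  continuation m X D sigma ->
  net_payoff m D sigma =
    fun p a => eq_payoff m (investors a) D - cost m * (own p a)%:R.
Proof.
move=> D0 ws inX e; apply/funext => p; apply/funext => a.
have n2 : (investors a <= 2)%N by case: a => [[] []].
have [_ E] := electoral_equilibrium_outcome (ws _ n2) (ideal_le _ _ D0)
  (inX _ n2) (e a).
by rewrite /net_payoff E /eq_payoff ideal_gap.
Qed.

Lemma continuation_exists (R : realType) (m : identity_model R) (X : interval R)
    (D : R) :
  0 <= D ->
  (forall n, (n <= 2)%N -> wide_support m (idealL m D n) (idealR m D n)) ->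
  (forall n, (n <= 2)%N -> `[idealL m D n, idealR m D n] `<=` [set` X]) ->
  exists sigma, continuation m X D sigma.
Proof.
move=> D0 ws inX.
suff /boolp.choice[sigma sigmaP] : forall a, exists x,
    electoral_equilibrium m X (idealL m D (investors a)) (idealR m D (investors a)) x.
  by exists sigma.
move=> a; have n2 : (investors a <= 2)%N by case: a => [[] []].
exact: electoral_equilibrium_exists (ws _ n2) (ideal_le _ _ D0) (inX _ n2).
Qed.

(** * Dominance and uniqueness in two-by-two games *)

(** The own entry of the two constant profiles is overwritten by [b]; what remains is the rival's
    action, [true] with probability [y]. *)
Definition reply (R : realType) (u : party -> bool * bool -> R) (p : party)
    (y : R) (b : bool) : R :=
  y * u p (deviate p (true, true) b) + (1 - y) * u p (deviate p (false, false) b).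

Lemma mixed_payoffE (R : realType) (u : party -> bool * bool -> R) (p : party)
    (q : R * R) :
  mixed_payoff u p q = own p q * reply u p (own (rival p) q) true
    + (1 - own p q) * reply u p (own (rival p) q) false.
Proof.
pose F (i j : bool) :=
  (if i then q.1 else 1 - q.1) * (if j then q.2 else 1 - q.2) * u p (i, j).
rewrite /mixed_payoff (eq_bigr (fun a => F a.1 a.2)); last by move=> [].
rewrite -(pair_bigA _ F) /= /F.
by rewrite !big_bool /reply; clear F; case: p => /=; ring.
Qed.

Lemma strictly_dominant_reply (R : realType) (u : party -> bool * bool -> R)
    (k : bool) (p : party) (y : R) :
  strictly_dominant u k -> 0 <= y <= 1 -> reply u p y (~~ k) < reply u p y k.
Proof.
move=> dom /andP[y0 y1]; have nk : ~~ k <> k by case: (k).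
have := dom p (true, true) _ nk; have := dom p (false, false) _ nk.
rewrite /reply; set a := u _ _; set b := u _ _; set c := u _ _; set d := u _ _.
move=> ab cd; rewrite -subr_gt0.
(* The gain is an average of two positive gaps; splitting off [y = 0] leaves a positive weight on
   the first. *)
have [->|yn0] := eqVneq y 0; first lra.
have : 0 < y by rewrite lt_def yn0.
nra.
Qed.

(** A mixed payoff is affine in the own probability, with a slope whose strict sign is fixed by
    dominance; its only maximizer on [[0, 1]] is the endpoint [k]. *)
Lemma strictly_dominant_unique (R : realType) (u : party -> bool * bool -> R)
    (k : bool) : strictly_dominant u k -> unique_equilibrium u (k, k).
Proof.
move=> dom; split.
  move=> a; split.
    move=> ne; have own_k p : own p a = k.
      have [_ /(_ k I)] := ne p; case: (eqVneq (own p a) k) => // /eqP nk.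
      have := dom p a _ nk.
      rewrite (_ : deviate p a (own p a) = a); last by case: (p); case: (a).
      by move=> /lt_le_trans h /h; rewrite ltxx.
    rewrite [a]surjective_pairing; congr pair.
      exact: own_k PartyA.
    exact: own_k PartyB.
  move=> -> p; split=> // x _; case: (eqVneq x k) => [->|/eqP nk].
    by case: p.
  by have := dom p (k, k) x nk; case: p => /= /ltW.
have range (b : bool) : 0 <= (b%:R : R) <= 1 by case: b; rewrite ?lexx ?ler01.
move=> q; split.
  move=> ne; have q01 p : 0 <= own p q <= 1.
    by have [] := ne p; rewrite /= in_itv.
  have own_k p : own p q = k%:R.
    have [_ /(_ k%:R)] := ne p; rewrite /= in_itv/= range => /(_ isT).
    have := strictly_dominant_reply p dom (q01 (rival p)).
    have := q01 p; rewrite !mixed_payoffE.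
    rewrite (_ : own p (deviate p q k%:R) = k%:R); last by case: (p).
    rewrite (_ : own (rival p) (deviate p q k%:R) = own (rival p) q);
      last by case: (p).
    move: (own p q) (reply u p (own (rival p) q)) => x w.
    case: (k) => /= /andP[x0 x1] lt le; apply: le_anti; apply/andP; split=> //.
      by rewrite leNgt; apply/negP => h; nra.
    by rewrite leNgt; apply/negP => h; nra.
  rewrite [q]surjective_pairing; congr pair.
    exact: own_k PartyA.
  exact: own_k PartyB.
move=> -> p; split; first by rewrite /= in_itv/=; case: p; rewrite /= range.
move=> x; rewrite /= in_itv/= => /andP[x0 x1].
have := strictly_dominant_reply p dom (range k); rewrite !mixed_payoffE.
have -> : own (rival p) (deviate p (k%:R : R, k%:R) x) = k%:R by case: (p).
have -> : own p (deviate p (k%:R : R, k%:R) x) = x by case: (p).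
have -> b : own b (k%:R : R, k%:R) = k%:R by case: b.
have -> : own (rival p) (k%:R : R, k%:R) = k%:R by case: (p).
move: (reply u p k%:R) => w.
by case: (k) => /= lt; nra.
Qed.

(** * Investment games whose gross payoff depends on the number of investors *)

Section InvestmentGame.
Variables (R : realType) (V : nat -> R) (c : R).
Let u (p : party) (a : bool * bool) : R := V (investors a) - c * (own p a)%:R.

Lemma invest_dominant : c < V 1%N - V 0%N -> c < V 2%N - V 1%N ->
  strictly_dominant u true.
Proof.
move=> c0 c1 p s [] // _; rewrite /u /investors.
by case: p; case: s => [[] []] /=; rewrite ?mulr1 ?mulr0 ?addn0 ?add0n ?addn1; lra.
Qed.

Lemma noninvest_dominant : V 1%N - V 0%N < c -> V 2%N - V 1%N < c ->
  strictly_dominant u false.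
Proof.
move=> c0 c1 p s [] // _; rewrite /u /investors.
by case: p; case: s => [[] []] /=; rewrite ?mulr1 ?mulr0 ?addn0 ?add0n ?addn1; lra.
Qed.

Lemma invest_pure : c <= V 2%N - V 1%N -> pure_equilibrium u (true, true).
Proof.
move=> c1 p; split=> // x _; rewrite /u /investors.
by case: p; case: x => /=; rewrite ?mulr1 ?mulr0 ?addn0 ?add0n ?addn1; lra.
Qed.

Lemma noninvest_pure : V 1%N - V 0%N <= c -> pure_equilibrium u (false, false).
Proof.
move=> c0 p; split=> // x _; rewrite /u /investors.
by case: p; case: x => /=; rewrite ?mulr1 ?mulr0 ?addn0 ?add0n ?addn1; lra.
Qed.

End InvestmentGame.

(** * An invariant interval of platform distances *)

(** The upper end is the fixed point of [D -> gamma * (d + 4 * eta * D)], the update under mutual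
    investment. *)
Definition stable_state (R : realType) (m : identity_model R) (D : R) : Prop :=
  initial_distance m <= D <= gamma m * dbar m.

Lemma initial_distance_gt0 (R : realType) (m : identity_model R) :
  0 < initial_distance m.
Proof. by rewrite mulr_gt0 ?gamma_gt0 ?baseline_gap_gt0. Qed.

Lemma stable_state_ge0 (R : realType) (m : identity_model R) (D : R) :
  stable_state m D -> 0 <= D.
Proof. by case/andP=> /(le_trans (ltW (initial_distance_gt0 m))). Qed.

(* [dbar] is the fixed point of the identity gap under mutual investment. *)
Lemma dbar_fixpoint (R : realType) (m : identity_model R) :
  4 * gamma m * identity_rate m < 1 ->
  dbar m = baseline_gap m + 4 * gamma m * identity_rate m * dbar m.
Proof. by move=> q1; rewrite /dbar; field; lra. Qed.

Lemma dbar_ge (R : realType) (m : identity_model R) :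
  4 * gamma m * identity_rate m < 1 -> baseline_gap m <= dbar m.
Proof.
move=> q1; have d0 := baseline_gap_gt0 m.
rewrite /dbar ler_pdivlMr; last lra.
rewrite ler_piMr ?ltW//; have := gamma_gt0 m; have := identity_rate_gt0 m.
by move: (identity_rate m) (gamma m) => e g *; nra.
Qed.

Section StableStates.
Variables (R : realType) (m : identity_model R).
Hypothesis q_lt1 : 4 * gamma m * identity_rate m < 1.
Hypothesis support : (baseline_gap m / (1 - 4 * gamma m * identity_rate m)) ^+ 2
  < phi m.
Let X := feasible_policies m.

(** The worst case is two investors at [D = gamma * dbar], where the gap is exactly [dbar]. Wide
    support, feasibility and invariance all follow from this bound. *)
Lemma stable_gap (D : R) (n : nat) : stable_state m D -> (n <= 2)%N ->
  baseline_gap m <= idealR m D n - idealL m D n <= dbar m.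
Proof.
move=> sD n2; have D0 := stable_state_ge0 sD; case/andP: sD => _ Dle.
have nR : n%:R <= 2 :> R by rewrite ler_nat.
have n0 : 0 <= n%:R :> R by [].
have e0 := identity_rate_gt0 m; have fix_dbar := dbar_fixpoint q_lt1.
rewrite ideal_gap lerDl; apply/andP; split.
  by rewrite !mulr_ge0// ltW.
rewrite [leRHS]fix_dbar lerD2l.
have eD : identity_rate m * D <= identity_rate m * (gamma m * dbar m).
  by rewrite ler_pM2l.
have eD0 : 0 <= identity_rate m * D by rewrite mulr_ge0// ltW.
by nra.
Qed.

Lemma stable_wide_support (D : R) : stable_state m D -> forall n, (n <= 2)%N ->
  wide_support m (idealL m D n) (idealR m D n).
Proof.
move=> sD n n2; have /andP[h1 h2] := stable_gap sD n2.
have d0 := baseline_gap_gt0 m.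
apply: le_lt_trans support; rewrite -/(dbar m) ler_pXn2r// nnegrE.
  by apply: le_trans h1; exact: ltW.
by apply: le_trans (dbar_ge q_lt1); exact: ltW.
Qed.

(** The ideals move symmetrically about a fixed midpoint, so bounding their gap by [dbar] is
    enough. *)
Lemma stable_feasible (D : R) : stable_state m D -> forall n, (n <= 2)%N ->
  `[idealL m D n, idealR m D n] `<=` [set` X].
Proof.
move=> sD n n2 x; have /andP[_] := stable_gap sD n2.
rewrite /X /feasible_policies /= !in_itv/= /idealL /idealR.
by move=> h /andP[h1 h2]; apply/andP; split; lra.
Qed.

Lemma stable_outcome (D : R) (a : bool * bool) (x : R * R) : stable_state m D ->
  electoral_equilibrium m X
    (idealL m D (investors a)) (idealR m D (investors a)) x ->
  `|x.1 - x.2| = gamma m * (baseline_gap m + 2 * (investors a)%:R * identity_rate m * D)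
  /\ stable_state m `|x.1 - x.2|.
Proof.
move=> sD e; have n2 : (investors a <= 2)%N by case: a {e} => [[] []].
have [-> _] := electoral_equilibrium_outcome (stable_wide_support sD n2)
  (ideal_le _ _ (stable_state_ge0 sD)) (stable_feasible sD n2) e.
rewrite -ideal_gap; split=> //.
by rewrite /stable_state !ler_pM2l ?gamma_gt0//; exact: stable_gap.
Qed.

Lemma stable_initial : stable_state m (initial_distance m).
Proof. by rewrite /stable_state lexx ler_pM2l ?gamma_gt0//; exact: dbar_ge. Qed.

Lemma reachable_stable (D : R) : reachable m X D -> stable_state m D.
Proof.
elim=> [|{}D a x _ sD e]; first exact: stable_initial.
by have [] := stable_outcome sD e.
Qed.

Lemma stable_continuation (D : R) : stable_state m D ->
  exists sigma, continuation m X D sigma.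
Proof.
move=> sD; exact: continuation_exists (stable_state_ge0 sD)
  (stable_wide_support sD) (stable_feasible sD).
Qed.

(** The initial distance is the least stable one, so both benefits at [D] are at least B_0 there. *)
Lemma stable_invest_dominant (D : R) (sigma : bool * bool -> R * R) :
  cost m < benefit m 0 (initial_distance m) -> stable_state m D ->
  continuation m X D sigma -> strictly_dominant (net_payoff m D sigma) true.
Proof.
move=> cB sD e.
rewrite (net_payoffE (stable_state_ge0 sD) (stable_wide_support sD)
  (stable_feasible sD) e).
have DD : 0 <= initial_distance m <= D.
  by rewrite ltW ?initial_distance_gt0//; case/andP: sD.
by apply: (@invest_dominant R (fun n => eq_payoff m n D)); apply: lt_le_trans cB _; exact: benefit_le.
Qed.

End StableStates.

Theorem mainTheorem13 (R : realType) (m : identity_model R) :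
  (forall (X : interval R) (D : R),
      0 < D -> cost m <> benefit m 0 D -> cost m <> benefit m 1 D ->
      (forall n, (n <= 2)%N -> wide_support m (idealL m D n) (idealR m D n)) ->
      (forall n, (n <= 2)%N ->
         `[idealL m D n, idealR m D n] `<=` [set` X]) ->
      (exists sigma, continuation m X D sigma) /\
      (forall sigma, continuation m X D sigma ->
         let u := net_payoff m D sigma in
         [/\ cost m < benefit m 0 D ->
               strictly_dominant u true /\ unique_equilibrium u (true, true),
             benefit m 0 D < cost m < benefit m 1 D ->
               pure_equilibrium u (true, true) /\
               pure_equilibrium u (false, false)
           & benefit m 1 D < cost m ->
               strictly_dominant u false /\
               unique_equilibrium u (false, false)])) /\
  (cost m < benefit m 0 (initial_distance m) ->
   4 * gamma m * identity_rate m < 1 ->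
   (baseline_gap m / (1 - 4 * gamma m * identity_rate m)) ^+ 2 < phi m ->
   let X := feasible_policies m in
   [/\ forall D, reachable m X D ->
         (exists sigma, continuation m X D sigma) /\
         (forall sigma, continuation m X D sigma ->
            strictly_dominant (net_payoff m D sigma) true),
       exists D a sigma, investment_path m X D a sigma
     & forall D a sigma, investment_path m X D a sigma ->
         [/\ forall t, a t = (true, true),
             forall t, D t = initial_distance m *
               \sum_(s < t.+1) (4 * gamma m * identity_rate m) ^+ s,
             D t @[t --> \oo] -->
               gamma m * baseline_gap m / (1 - 4 * gamma m * identity_rate m),
             {homo identity_gap m D a : s t / (s < t)%N >-> s < t}
           & identity_gap m D a 0%N = baseline_gap m /\
             identity_gap m D a t @[t --> \oo] --> dbar m]]).
Proof.
split.
  move=> X D D0 _ _ ws inX; split; first exact: continuation_exists (ltW D0) ws inX.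
  move=> sigma e u; rewrite /u (net_payoffE (ltW D0) ws inX e) {u}.
  (* Since B_0 is at most B_1, comparing the cost with one threshold settles both replies in the two
     dominance cases. *)
  have B01 : benefit m 0 D <= benefit m 1 D by rewrite benefit_le// lexx ltW.
  pose V n := eq_payoff m n D.
  split=> [c0|/andP[c0 c1]|c1].
  - have dom := @invest_dominant R V _ c0 (lt_le_trans c0 B01).
    by split=> //; exact: strictly_dominant_unique.
  - by split; [apply: (@invest_pure R V)|apply: (@noninvest_pure R V)]; exact: ltW.
  - have dom := @noninvest_dominant R V _ (le_lt_trans B01 c1) c1.
    by split=> //; exact: strictly_dominant_unique.
move=> cB q1 supp X.
have dom D sigma : stable_state m D -> continuation m X D sigma ->
    strictly_dominant (net_payoff m D sigma) true.
  exact: stable_invest_dominant.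
split.
- move=> D /(reachable_stable q1 supp) sD; split; last by move=> sigma; exact: dom.
  exact: stable_continuation.
(* The default [(0, 0)] at unstable distances is never reached: the path built from [sg] stays in
   the stable interval. *)
- have /boolp.choice[sg sgP] : forall D, exists sigma,
      stable_state m D -> continuation m X D sigma.
    move=> D; have [sD|nD] := pselect (stable_state m D); last by exists (fun=> (0, 0)).
    by have [sigma e] := stable_continuation q1 supp sD; exists sigma.
  pose next D := `|(sg D (true, true)).1 - (sg D (true, true)).2|.
  pose D t := iter t next (initial_distance m).
  have sD t : stable_state m (D t).
    elim: t => [|t ih]; first exact: stable_initial.
    by have [] := stable_outcome q1 supp ih (sgP _ ih (true, true)).
  exists D, (fun=> (true, true)), (fun t => sg (D t)); split=> // t.
    exact: sgP.
  by apply/(strictly_dominant_unique (dom _ _ (sD t) (sgP _ (sD t)))).1.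
move=> D a sigma [D0 cont ne step].
have sD t : stable_state m (D t).
  elim: t => [|t ih]; first by rewrite D0; exact: stable_initial.
  by rewrite step; have [] := stable_outcome q1 supp ih (cont t (a t)).
have aT t : a t = (true, true).
  exact/((strictly_dominant_unique (dom _ _ (sD t) (cont t))).1 (a t)).1.
have n2 : (investors (true, true))%:R = 2 :> R by [].
set q := 4 * gamma m * identity_rate m.
have q0 : 0 < q by rewrite !mulr_gt0 ?gamma_gt0 ?identity_rate_gt0.
have DS t : D t.+1 = initial_distance m + q * D t.
  have [+ _] := stable_outcome q1 supp (sD t) (cont t (a t)).
  by rewrite -step => ->; rewrite aT n2 /initial_distance /q; ring.
have Dsum t : D t = initial_distance m * \sum_(s < t.+1) q ^+ s.
  elim: t => [|t ih]; first by rewrite big_ord1 expr0 mulr1.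
  rewrite DS ih [in RHS]big_ord_recl expr0 mulrDr mulr1 mulrCA; congr (_ + _ * _).
  by rewrite mulr_sumr; apply: eq_bigr => i _; rewrite /= -exprS.
(* Each distance is [gamma] times the gap of the same election, also at index 0, so growth and limit
   of the gap are read off [D]. *)
have gapE t : identity_gap m D a t = D t / gamma m.
  have g0 : gamma m != 0 by rewrite gt_eqF ?gamma_gt0.
  case: t => [|t] /=; first by rewrite D0 /initial_distance; field.
  by rewrite ideal_gap aT n2 DS /initial_distance /q; field.
have Dlim : D t @[t --> \oo] --> gamma m * baseline_gap m / (1 - q).
  (* [D t] has [t.+1] terms while [series] at [n] sums [n] terms, hence the shift. *)
  have -> : D = [sequence series (geometric (initial_distance m) q) n.+1]_n.
    apply/funext => t; rewrite Dsum /series /= big_mkord mulr_sumr.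
    by apply: eq_bigr.
  rewrite cvg_shiftS; apply: cvg_geometric_series.
  by rewrite gtr0_norm.
split=> //.
- apply: homo_ltn => [|t]; first exact: lt_trans.
  rewrite !gapE ltr_pM2r ?invr_gt0 ?gamma_gt0// !Dsum [X in _ < _ * X]big_ord_recr /= mulrDr ltrDl.
  by rewrite mulr_gt0 ?initial_distance_gt0 ?exprn_gt0.
- split=> //.
  have -> : identity_gap m D a = fun t => D t / gamma m by exact/funext.
  have -> : dbar m = gamma m * baseline_gap m / (1 - q) / gamma m.
    rewrite /dbar -/q; field; rewrite gt_eqF ?gamma_gt0//=.
    by rewrite subr_eq0 gt_eqF.
  exact: cvgMr_tmp.
Qed.
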